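(* The diskew polynomial ring $E=D[x,y;\sigma,\tau,b,\rho]$ is an iterated skew polynomial ring $E=D[y;\tau][x;\sigma,\partial]$ where $\sigma(y)=\rho y$, $\partial(D)=0$ and $\partial(y)=b$. It is a free left $D$-module $E=\bigoplus_{i,j\in\mathbb{N}}Dy^ix^j$ and the element $x$ is a left regular element.
   Context: Diskew polynomial ring: let $D$ be a ring, $\sigma,\tau$ ring endomorphisms of $D$, and $\rho,b\in D$ such that $\sigma\tau(d)\rho=\rho\,\tau\sigma(d)$ and $\sigma\tau(d)b=bd$ for all $d\in D$. Then $E=D[x,y;\sigma,\tau,b,\rho]$ is the ring generated by $D$, $x$ and $y$ subject to the defining relations $xd=\sigma(d)x$, $yd=\tau(d)y$ for all $d\in D$, and $xy-\rho yx=b$. Products of endomorphisms are compositions. Here $D[y;\tau]$ is the skew polynomial ring with $yd=\tau(d)y$; $\sigma$ also denotes the extension of $\sigma$ to a ring endomorphism of $R=D[y;\tau]$ with $\sigma(y)=\rho y$; $\partial$ is a $\sigma$-derivation of $R$ (additive, $\partial(rs)=\partial(r)s+\sigma(r)\partial(s)$), and $R[x;\sigma,\partial]$ has the relation $xr=\sigma(r)x+\partial(r)$. $\mathbb{N}=\{0,1,2,\ldots\}$. An element $r$ of a ring is left regular if $r'r=0$ implies $r'=0$. *)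

(* Defs.v *)
From HB Require Import structures.
From mathcomp Require Import all_boot all_order all_algebra generic_quotient.
From mathcomp Require Import boolp.

Set Implicit Arguments.
Unset Strict Implicit.
Unset Printing Implicit Defensive.

Import GRing.Theory.
Local Open Scope ring_scope.
Local Open Scope quotient_scope.

(* Rings are associative and unital ([pzRingType]: the zero ring is allowed,
   nothing is assumed commutative). *)

(* The ring generated by a ring D and a set G of generators subject to a set of
   relations [rel]: formal ring expressions modulo the least congruence that
   contains [rel], makes the quotient a ring and makes D -> quotient a ring
   morphism.  The zero and the one are the images of 0 and 1 in D. *)
Inductive term (D G : Type) : Type :=
| Cst of D
| Gen of G
| Add of term D G & term D G
| Opp of term D G
| Mul of term D G & term D G.
Arguments Cst {D G}.
Arguments Gen {D G}.

HB.instance Definition _ (D G : Type) := gen_eqMixin (term D G).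
HB.instance Definition _ (D G : Type) := gen_choiceMixin (term D G).

Section Presentation.
Variables (D : pzRingType) (G : Type) (rel : term D G -> term D G -> Prop).
Local Notation T := (term D G).

Inductive cong : T -> T -> Prop :=
| cong_rel s t : rel s t -> cong s t
| cong_refl s : cong s s
| cong_sym s t : cong s t -> cong t s
| cong_trans s t u : cong s t -> cong t u -> cong s u
| cong_add s s' t t' : cong s s' -> cong t t' -> cong (Add s t) (Add s' t')
| cong_opp s s' : cong s s' -> cong (Opp s) (Opp s')
| cong_mul s s' t t' : cong s s' -> cong t t' -> cong (Mul s t) (Mul s' t')
| cong_addA s t u : cong (Add s (Add t u)) (Add (Add s t) u)
| cong_addC s t : cong (Add s t) (Add t s)
| cong_add0 s : cong (Add (Cst 0) s) s
| cong_addN s : cong (Add (Opp s) s) (Cst 0)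
| cong_mulA s t u : cong (Mul s (Mul t u)) (Mul (Mul s t) u)
| cong_mul1l s : cong (Mul (Cst 1) s) s
| cong_mul1r s : cong (Mul s (Cst 1)) s
| cong_mulDl s t u : cong (Mul (Add s t) u) (Add (Mul s u) (Mul t u))
| cong_mulDr s t u : cong (Mul s (Add t u)) (Add (Mul s t) (Mul s u))
| cong_cstD c d : cong (Cst (c + d)) (Add (Cst c) (Cst d))
| cong_cstM c d : cong (Cst (c * d)) (Mul (Cst c) (Cst d)).

Definition congb (s t : T) : bool := `[< cong s t >].

Fact congb_refl : reflexive congb.
Proof. by move=> s; apply/asboolP; exact: cong_refl. Qed.
Fact congb_sym : symmetric congb.
Proof. by move=> s t; apply/asboolP/asboolP; exact: cong_sym. Qed.
Fact congb_trans : transitive congb.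
Proof.
move=> t s u /asboolP st /asboolP tu; apply/asboolP; exact: cong_trans st tu.
Qed.

Canonical cong_equiv := EquivRel congb congb_refl congb_sym congb_trans.

Definition presented : Type := {eq_quot cong_equiv}.
HB.instance Definition _ := Choice.on presented.

Definition pclass (t : T) : presented := \pi_({eq_quot cong_equiv}) t.
Definition prepr (a : presented) : T := repr (a : {eq_quot cong_equiv}).

Lemma preprK : cancel prepr pclass.
Proof. exact: reprK. Qed.

Lemma pclassP s t : pclass s = pclass t <-> cong s t.
Proof.
split; first by move/eqmodP/asboolP.
by move=> st; apply/eqmodP/asboolP.
Qed.

Lemma prepr_pclass t : cong (prepr (pclass t)) t.
Proof. by apply/pclassP; rewrite preprK. Qed.

Definition padd (a b : presented) := pclass (Add (prepr a) (prepr b)).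
Definition popp (a : presented) := pclass (Opp (prepr a)).
Definition pmul (a b : presented) := pclass (Mul (prepr a) (prepr b)).

Lemma pclassD s t : pclass (Add s t) = padd (pclass s) (pclass t).
Proof.
by apply/pclassP/cong_sym/cong_add; exact: prepr_pclass.
Qed.
Lemma pclassN s : pclass (Opp s) = popp (pclass s).
Proof. by apply/pclassP/cong_sym/cong_opp; exact: prepr_pclass. Qed.
Lemma pclassM s t : pclass (Mul s t) = pmul (pclass s) (pclass t).
Proof.
by apply/pclassP/cong_sym/cong_mul; exact: prepr_pclass.
Qed.

Fact paddA : associative padd.
Proof.
move=> a b c; rewrite -[a]preprK -[b]preprK -[c]preprK -!pclassD.
by apply/pclassP; exact: cong_addA.
Qed.
Fact paddC : commutative padd.
Proof.
by move=> a b; apply/pclassP; exact: cong_addC.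
Qed.
Fact padd0 : left_id (pclass (Cst 0)) padd.
Proof.
by move=> a; rewrite -[a]preprK -!pclassD; apply/pclassP; exact: cong_add0.
Qed.
Fact paddN : left_inverse (pclass (Cst 0)) popp padd.
Proof.
move=> a; rewrite -[a]preprK -pclassN -!pclassD.
by apply/pclassP; exact: cong_addN.
Qed.
HB.instance Definition _ :=
  GRing.isZmodule.Build presented paddA paddC padd0 paddN.

Fact pmulA : associative pmul.
Proof.
move=> a b c; rewrite -[a]preprK -[b]preprK -[c]preprK -!pclassM.
by apply/pclassP; exact: cong_mulA.
Qed.
Fact pmul1l : left_id (pclass (Cst 1)) pmul.
Proof.
by move=> a; rewrite -[a]preprK -!pclassM; apply/pclassP; exact: cong_mul1l.
Qed.
Fact pmul1r : right_id (pclass (Cst 1)) pmul.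
Proof.
by move=> a; rewrite -[a]preprK -!pclassM; apply/pclassP; exact: cong_mul1r.
Qed.
Fact pmulDl : left_distributive pmul padd.
Proof.
move=> a b c; rewrite -[a]preprK -[b]preprK -[c]preprK.
by rewrite -!(pclassM, pclassD); apply/pclassP; exact: cong_mulDl.
Qed.
Fact pmulDr : right_distributive pmul padd.
Proof.
move=> a b c; rewrite -[a]preprK -[b]preprK -[c]preprK.
by rewrite -!(pclassM, pclassD); apply/pclassP; exact: cong_mulDr.
Qed.
HB.instance Definition _ := GRing.Zmodule_isPzRing.Build presented
  pmulA pmul1l pmul1r pmulDl pmulDr.

Definition pcst (d : D) : presented := pclass (Cst d).
Definition pgen (g : G) : presented := pclass (Gen g).

Fact pcst_additive : zmod_morphism pcst.
Proof.
have cD c d : pcst (c + d) = pcst c + pcst d.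
  by rewrite -[RHS]pclassD; apply/pclassP; exact: cong_cstD.
by move=> c d; apply/eqP; rewrite eq_sym subr_eq -cD subrK.
Qed.
Fact pcst_multiplicative : monoid_morphism pcst.
Proof.
split=> // c d.
by rewrite -[RHS]pclassM; apply/pclassP; exact: cong_cstM.
Qed.
HB.instance Definition _ :=
  GRing.isZmodMorphism.Build D presented pcst pcst_additive.
HB.instance Definition _ :=
  GRing.isMonoidMorphism.Build D presented pcst pcst_multiplicative.

Fixpoint eval (S : pzRingType) (f : D -> S) (g : G -> S) (t : T) : S :=
  match t with
  | Cst d => f d
  | Gen i => g i
  | Add s t => eval f g s + eval f g t
  | Opp s => - eval f g s
  | Mul s t => eval f g s * eval f g t
  end.

Lemma eval_pclass t : eval pcst pgen t = pclass t.
Proof.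
elim: t => //= [s -> t ->|s ->|s -> t ->].
- by rewrite pclassD.
- by rewrite pclassN.
- by rewrite pclassM.
Qed.

Lemma presented_rel s t : rel s t -> eval pcst pgen s = eval pcst pgen t.
Proof. by move=> st; rewrite !eval_pclass; apply/pclassP/cong_rel. Qed.

Lemma eval_cong (S : pzRingType) (f : {rmorphism D -> S}) (g : G -> S) :
  (forall s t, rel s t -> eval f g s = eval f g t) ->
  forall s t, cong s t -> eval f g s = eval f g t.
Proof.
move=> frel s t; elim=> {s t} /=; first by move=> s t /frel.
- by [].
- by move=> s t _ ->.
- by move=> s t u _ -> _ ->.
- by move=> s s' t t' _ -> _ ->.
- by move=> s s' _ ->.
- by move=> s s' t t' _ -> _ ->.
- by move=> *; exact: addrA.
- by move=> *; exact: addrC.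
- by move=> *; rewrite rmorph0 add0r.
- by move=> *; rewrite rmorph0 addNr.
- by move=> *; exact: mulrA.
- by move=> *; rewrite rmorph1 mul1r.
- by move=> *; rewrite rmorph1 mulr1.
- by move=> *; exact: mulrDl.
- by move=> *; exact: mulrDr.
- by move=> *; exact: rmorphD.
- by move=> *; exact: rmorphM.
Qed.

Lemma presented_univ (S : pzRingType) (f : {rmorphism D -> S}) (g : G -> S) :
  (forall s t, rel s t -> eval f g s = eval f g t) ->
  exists h : {rmorphism presented -> S},
    [/\ forall d, h (pcst d) = f d, forall i, h (pgen i) = g i
      & forall h' : {rmorphism presented -> S},
          (forall d, h' (pcst d) = f d) -> (forall i, h' (pgen i) = g i) ->
          forall a, h' a = h a].
Proof.
move=> frel; pose h0 (a : presented) := eval f g (prepr a).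
have h0E t : h0 (pclass t) = eval f g t.
  by apply: (eval_cong frel); exact: prepr_pclass.
have h0D : zmod_morphism h0.
  move=> a b; rewrite -[a]preprK -[b]preprK.
  have -> : pclass (prepr a) - pclass (prepr b)
          = pclass (Add (prepr a) (Opp (prepr b))) by rewrite pclassD pclassN.
  by rewrite !h0E.
have h0M : monoid_morphism h0.
  split; first by rewrite -[1]/(pclass (Cst 1)) h0E /= rmorph1.
  move=> a b; rewrite -[a]preprK -[b]preprK.
  have -> : pclass (prepr a) * pclass (prepr b)
          = pclass (Mul (prepr a) (prepr b)) by rewrite pclassM.
  by rewrite !h0E.
pose hD := GRing.isZmodMorphism.Build _ _ h0 h0D.
pose hM := GRing.isMonoidMorphism.Build _ _ h0 h0M.
pose h : {rmorphism presented -> S} := HB.pack h0 hD hM.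
exists h; split=> [d|i|h' h'c h'g a]; [exact: h0E | exact: h0E|].
rewrite -[a]preprK [RHS]h0E -eval_pclass.
elim: (prepr a) => //= [s IHs t IHt|s IHs|s IHs t IHt].
- by rewrite rmorphD IHs IHt.
- by rewrite rmorphN IHs.
- by rewrite rmorphM IHs IHt.
Qed.

End Presentation.

Inductive xy : Type := gen_x | gen_y.

Inductive diskew_rel (D : pzRingType) (sigma tau : D -> D) (b rho : D) :
    term D xy -> term D xy -> Prop :=
| diskew_xd d : diskew_rel sigma tau b rho
    (Mul (Gen gen_x) (Cst d)) (Mul (Cst (sigma d)) (Gen gen_x))
| diskew_yd d : diskew_rel sigma tau b rho
    (Mul (Gen gen_y) (Cst d)) (Mul (Cst (tau d)) (Gen gen_y))
| diskew_xy : diskew_rel sigma tau b rho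
    (Add (Mul (Gen gen_x) (Gen gen_y))
         (Opp (Mul (Cst rho) (Mul (Gen gen_y) (Gen gen_x)))))
    (Cst b).

Section Diskew.
Variables (D : pzRingType) (sigma tau : {rmorphism D -> D}) (b rho : D).

Definition diskew : pzRingType := presented (diskew_rel sigma tau b rho).
Definition diskew_cst : {rmorphism D -> diskew} :=
  @pcst D xy (diskew_rel sigma tau b rho).
Definition diskew_x : diskew := pgen (diskew_rel sigma tau b rho) gen_x.
Definition diskew_y : diskew := pgen (diskew_rel sigma tau b rho) gen_y.

Lemma diskew_relE :
  [/\ forall d, diskew_x * diskew_cst d = diskew_cst (sigma d) * diskew_x,
      forall d, diskew_y * diskew_cst d = diskew_cst (tau d) * diskew_y
    & diskew_x * diskew_y - diskew_cst rho * (diskew_y * diskew_x)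
      = diskew_cst b].
Proof.
split=> [d|d|].
- exact: (presented_rel (diskew_xd sigma tau b rho d)).
- exact: (presented_rel (diskew_yd sigma tau b rho d)).
- exact: (presented_rel (diskew_xy sigma tau b rho)).
Qed.

End Diskew.

(* A ring S as a left R-module through a ring morphism iota : R -> S. *)
Section RestrictScalars.
Variables (R S : pzRingType) (iota : {rmorphism R -> S}).

Definition left_mod : Type := let _ := iota in S.
HB.instance Definition _ := GRing.Zmodule.on left_mod.

Definition lm_scale (a : R) (v : left_mod) : left_mod := iota a * (v : S).

Fact lm_scaleA a c v : lm_scale a (lm_scale c v) = lm_scale (a * c) v.
Proof. by rewrite /lm_scale rmorphM mulrA. Qed.
Fact lm_scale1 : left_id 1 lm_scale.
Proof. by move=> v; rewrite /lm_scale rmorph1 mul1r. Qed.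
Fact lm_scaleDr : right_distributive lm_scale +%R.
Proof. by move=> a u v; exact: mulrDr. Qed.
Fact lm_scaleDl v : {morph lm_scale^~ v : a c / a + c}.
Proof. by move=> a c; rewrite /lm_scale rmorphD; exact: mulrDl. Qed.
HB.instance Definition _ := GRing.Zmodule_isLmodule.Build R left_mod
  lm_scaleA lm_scale1 lm_scaleDr lm_scaleDl.

End RestrictScalars.

(* The family B is a basis of the (possibly infinitely generated) module V. *)
Definition is_basis (R : pzRingType) (V : lmodType R) (I : eqType) (B : I -> V)
    : Prop :=
  (forall v : V, exists (s : seq I) (c : I -> R), v = \sum_(i <- s) c i *: B i)
  /\ (forall (s : seq I) (c : I -> R), uniq s ->
        \sum_(i <- s) c i *: B i = 0 -> forall i, i \in s -> c i = 0).

Definition is_skew_derivation (R : pzRingType) (sigma : {rmorphism R -> R})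
    (delta : R -> R) : Prop :=
  (forall r s, delta (r + s) = delta r + delta s) /\
  (forall r s, delta (r * s) = delta r * s + sigma r * delta s).

(* S = R[x; sigma, delta]: S is a ring containing (through iota) the ring R, it
   is a free left R-module with basis 1, x, x^2, ... and
   x r = sigma(r) x + delta(r).  Injectivity of iota is part of freeness. *)
Definition is_skew_poly (R S : pzRingType) (iota : {rmorphism R -> S}) (x : S)
    (sigma : {rmorphism R -> R}) (delta : R -> R) : Prop :=
  [/\ is_skew_derivation sigma delta,
      is_basis (fun i : nat => x ^+ i : left_mod iota)
    & forall r, x * iota r = iota (sigma r) * x + iota (delta r)].

(* This is cancellation on the right, i.e. [GRing.rreg], not [GRing.lreg]. *)
Definition left_regular (R : pzRingType) (r : R) : Prop :=
  forall r' : R, r' * r = 0 -> r' = 0.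

(* Main.v *)
Require Import Defs.
From HB Require Import structures.
From mathcomp Require Import all_boot all_order all_algebra.
From mathcomp Require Import boolp functions.

(** Let R = D<y> / (y d = tau(d) y).  The two hypotheses on rho and b say
    exactly that y |-> [[rho y, b], [0, y]] and d |-> [[sigma(d), 0], [0, d]]
    respect the relation y d = tau(d) y, so they define a ring morphism from R
    to the upper triangular 2 x 2 matrices over R whose lower right entry is
    the identity.  Such a morphism is the same thing as an endomorphism of R
    (upper left entry) together with a skew derivation for it (upper right
    entry); this produces the extension of sigma and the derivation of the
    statement ([diskew_derivation]).

    Both R over D and E over R are then recognised as skew polynomial rings by
    one criterion ([is_skew_poly_of_rep]).  Powers of x span because the span
    is stable under left multiplication by the generators.  They are
    independent because the ring acts on the sequences over the base ring,
    thought of as formal series sum_n f_n x^n, where x sends f to the series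
    with coefficients sigma(f_(n-1)) + delta(f_n): no finiteness condition is
    involved, so the module is the full group of functions nat -> R.  The
    element x^i sends the series 1 to x^i, hence a combination of powers of x
    acting as 0 has zero coefficients.  Since the rings at hand are given by
    generators and relations, to define the action it suffices to check these
    relations in the endomorphism ring of the group of sequences.

    Composing the two bases gives the D-basis y^i x^j of E ([basis_tower]), and
    right multiplication by x shifts the basis x^j over R, hence is injective
    ([skew_poly_left_regular]). *)

Set Implicit Arguments.
Unset Strict Implicit.
Unset Printing Implicit Defensive.

Import GRing.Theory.
Local Open Scope ring_scope.

(** * Endomorphism rings *)

Section EndomorphismRing.
Variable M : zmodType.

Definition endo := {f : M -> M | `[< {morph f : u v / u + v} >]}.
HB.instance Definition _ := Choice.on endo.

Definition endo_of (f : M -> M) (fD : {morph f : u v / u + v}) : endo :=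
  exist _ f (asboolT fD).

Lemma endoD (f : endo) : {morph val f : u v / u + v}.
Proof. by case: f => f /= /asboolP. Qed.

Lemma endoP (f g : endo) : val f =1 val g -> f = g.
Proof. by move=> fg; apply/val_inj/funext. Qed.

Fact endo_zero_subproof : {morph (fun _ : M => 0 : M) : u v / u + v}.
Proof. by move=> u v; rewrite addr0. Qed.
Fact endo_opp_subproof (f : endo) : {morph (fun u => - val f u) : u v / u + v}.
Proof. by move=> u v; rewrite endoD opprD. Qed.
Fact endo_add_subproof (f g : endo) :
  {morph (fun u => val f u + val g u) : u v / u + v}.
Proof. by move=> u v; rewrite !endoD addrACA. Qed.
Fact endo_one_subproof : {morph (fun u : M => u) : u v / u + v}.
Proof. by []. Qed.
Fact endo_mul_subproof (f g : endo) :
  {morph (fun u => val f (val g u)) : u v / u + v}.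
Proof. by move=> u v; rewrite !endoD. Qed.

Let endo_zero := endo_of endo_zero_subproof.
Let endo_opp f := endo_of (endo_opp_subproof f).
Let endo_add f g := endo_of (endo_add_subproof f g).
Let endo_one := endo_of endo_one_subproof.
Let endo_mul f g := endo_of (endo_mul_subproof f g).

Fact endo_addA : associative endo_add.
Proof. by move=> f g h; apply: endoP => u; exact: addrA. Qed.
Fact endo_addC : commutative endo_add.
Proof. by move=> f g; apply: endoP => u; exact: addrC. Qed.
Fact endo_add0 : left_id endo_zero endo_add.
Proof. by move=> f; apply: endoP => u; exact: add0r. Qed.
Fact endo_addN : left_inverse endo_zero endo_opp endo_add.
Proof. by move=> f; apply: endoP => u; exact: addNr. Qed.
HB.instance Definition _ :=
  GRing.isZmodule.Build endo endo_addA endo_addC endo_add0 endo_addN.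

Fact endo_mulA : associative endo_mul.
Proof. by move=> f g h; apply: endoP. Qed.
Fact endo_mul1l : left_id endo_one endo_mul.
Proof. by move=> f; apply: endoP. Qed.
Fact endo_mul1r : right_id endo_one endo_mul.
Proof. by move=> f; apply: endoP. Qed.
Fact endo_mulDl : left_distributive endo_mul +%R.
Proof. by move=> f g h; apply: endoP. Qed.
Fact endo_mulDr : right_distributive endo_mul +%R.
Proof. by move=> f g h; apply: endoP => u; exact: endoD. Qed.
HB.instance Definition _ := GRing.Zmodule_isPzRing.Build endo
  endo_mulA endo_mul1l endo_mul1r endo_mulDl endo_mulDr.

Lemma endo_addE (f g : endo) u : val (f + g) u = val f u + val g u.
Proof. by []. Qed.
Lemma endo_mulE (f g : endo) u : val (f * g) u = val f (val g u).
Proof. by []. Qed.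
Lemma endo_sumE (I : Type) (s : seq I) (F : I -> endo) u :
  val (\sum_(i <- s) F i) u = \sum_(i <- s) val (F i) u.
Proof. by elim/big_rec2: _ => // i v f _ <-. Qed.

End EndomorphismRing.

(** * Presented rings *)

Lemma presented_ind (D : pzRingType) (G : Type)
    (rel : term D G -> term D G -> Prop) (P : presented rel -> Prop) :
  (forall a c, P a -> P c -> P (a + c)) -> (forall a, P a -> P (- a)) ->
  (forall a c, P a -> P c -> P (a * c)) ->
  (forall d, P (pcst rel d)) -> (forall i, P (pgen rel i)) ->
  forall a, P a.
Proof.
move=> PD PN PM Pcst Pgen a; rewrite -[a]preprK -eval_pclass.
by elim: (prepr a) => //= [s Ps t Pt|s Ps|s Ps t Pt];
  [exact: PD | exact: PN | exact: PM].
Qed.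

(** * Bases *)

(** Restriction of scalars leaves the additive group unchanged, so combinations
    in the module may be computed with the product of S. *)
Lemma left_mod_sumE (R S : pzRingType) (iota : {rmorphism R -> S})
    (I : Type) (s : seq I) (c : I -> R) (B : I -> S) :
  \sum_(i <- s) c i *: (B i : left_mod iota)
    = \sum_(i <- s) iota (c i) * B i :> S.
Proof. by []. Qed.

(** Spanning families come with lists of indices that may repeat; this groups
    the terms of such a list by the value of an index. *)
Lemma sum_undup_map (V : nmodType) (I J : eqType) (p : I -> J) (s : seq I)
    (F : I -> V) :
  \sum_(j <- undup (map p s)) \sum_(i <- s | p i == j) F i
    = \sum_(i <- s) F i.
Proof.
under eq_bigr do rewrite big_mkcond.
rewrite exchange_big big_seq [RHS]big_seq; apply: eq_bigr => i si.
rewrite (bigD1_seq (p i)) ?undup_uniq ?mem_undup ?map_f //= eqxx big1 ?addr0 //.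
by move=> j; rewrite eq_sym => /negPf ->.
Qed.

(** Collecting the coefficients of a repeated index makes the list of indices
    duplicate-free, which is the form in which independence applies. *)
Lemma basis_span_uniq (R : pzRingType) (V : lmodType R) (I : eqType)
    (B : I -> V) :
  is_basis B ->
  forall v, exists (s : seq I) (c : I -> R),
    uniq s /\ v = \sum_(i <- s) c i *: B i.
Proof.
case=> spanB _ v; have [s [c ->]] := spanB v.
exists (undup s), (fun j => \sum_(i <- s | i == j) c i).
split; first exact: undup_uniq.
rewrite -[in RHS](map_id s) -(sum_undup_map id); apply: eq_bigr => j _.
by rewrite map_id scaler_suml; apply: eq_bigr => i /eqP ->.
Qed.

(** Transitivity of freeness: expand the coefficients on C in terms of B; for
    independence, group a vanishing combination by its C-component. *)
Lemma basis_tower (D R E : pzRingType) (iR : {rmorphism D -> R})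
    (iE : {rmorphism D -> E}) (j : {rmorphism R -> E}) (I J : eqType)
    (B : I -> R) (C : J -> E) :
  (forall d, j (iR d) = iE d) ->
  is_basis (B : I -> left_mod iR) -> is_basis (C : J -> left_mod j) ->
  is_basis (fun k : I * J => j (B k.1) * C k.2 : left_mod iE).
Proof.
move=> jiR [spanB freeB] [spanC freeC]; split=> [v|s c s_uniq].
  have [s [c vE]] := spanC v.
  (* The lists and coefficients expanding each [c k] must be chosen uniformly
     in k, as a single coefficient function on pairs is required. *)
  have {spanB} [sB /choice [cB cE]] : exists sB : J -> seq I,
      forall k, exists d : I -> D, c k = \sum_(i <- sB k) iR (d i) * B i.
    have /choice [sB cE] : forall k, exists (t : seq I), exists d : I -> D,
        c k = \sum_(i <- t) iR (d i) * B i by move=> k; exact: spanB.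
    by exists sB.
  exists [seq (i, k) | k <- s, i <- sB k], (fun k => cB k.2 k.1).
  rewrite big_allpairs_dep [LHS]vE; apply: eq_bigr => k _.
  rewrite left_mod_sumE.
  rewrite [LHS](_ : _ = j (c k) * C k) // cE rmorph_sum mulr_suml.
  by apply: eq_bigr => i _; rewrite rmorphM jiR mulrA.
rewrite left_mod_sumE => sum0 [i k] ik_s /=.
pose cB h : R := \sum_(p <- s | p.2 == h) iR (c p) * B p.1.
have cB0 : cB k = 0.
  apply: (freeC (undup (map snd s))); rewrite ?undup_uniq //; last first.
    by rewrite mem_undup; apply/mapP; exists (i, k).
  rewrite left_mod_sumE -[RHS]sum0 -[RHS](sum_undup_map snd).
  apply: eq_bigr => h _; rewrite rmorph_sum mulr_suml.
  by apply: eq_bigr => p /eqP <-; rewrite rmorphM jiR mulrA.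
pose t := [seq p.1 | p <- s & p.2 == k].
have t_uniq : uniq t.
  rewrite map_inj_in_uniq ?filter_uniq // => -[i1 k1] [i2 k2].
  by rewrite !mem_filter /= => /andP[/eqP -> _] /andP[/eqP -> _] ->.
apply: (freeB t (fun i => c (i, k)) t_uniq); last first.
  by apply/mapP; exists (i, k); rewrite // mem_filter eqxx.
rewrite left_mod_sumE -[RHS]cB0 big_map big_filter.
by apply: eq_bigr => -[i' k'] /= /eqP ->.
Qed.

(** * Skew polynomial rings *)

(** Right multiplication by x sends x^i to x^(i+1), leaving the coefficients in
    place on the left, so it maps a basis injectively into itself. *)
Lemma skew_poly_left_regular (R S : pzRingType) (iota : {rmorphism R -> S})
    (x : S) (sigma : {rmorphism R -> R}) (delta : R -> R) :
  is_skew_poly iota x sigma delta -> left_regular x.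
Proof.
case=> _ xB _ r; have [s [c [s_uniq ->]]] := basis_span_uniq xB r.
rewrite left_mod_sumE mulr_suml => sum0.
rewrite big1_seq // => i /= si.
have -> : c i = 0; last by rewrite rmorph0 mul0r.
apply: (xB.2 (map succn s) (c \o predn)  _ _ i.+1).
- by rewrite map_inj_uniq //; exact: succn_inj.
- rewrite left_mod_sumE big_map -[RHS]sum0.
  by apply: eq_bigr => k _; rewrite exprSr mulrA.
- by rewrite mem_map //; exact: succn_inj.
Qed.

Section SkewDerivation.
Variables (R : pzRingType) (sigma : {rmorphism R -> R}) (delta : R -> R).
Hypothesis delta_der : is_skew_derivation sigma delta.

Lemma skew_derivation0 : delta 0 = 0.
Proof. by apply: (addIr (delta 0)); rewrite -delta_der.1 !add0r. Qed.

Lemma skew_derivation1 : delta 1 = 0.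
Proof.
have := delta_der.2 1 1; rewrite !mulr1 rmorph1 mul1r => delta1.
by apply: (addIr (delta 1)); rewrite -delta1 add0r.
Qed.

Lemma skew_derivationN r : delta (- r) = - delta r.
Proof. by apply/eqP; rewrite -addr_eq0 -delta_der.1 addNr skew_derivation0. Qed.

Fact scale_coef_subproof r :
  {morph (fun (f : nat -> R) n => r * f n) : f g / f + g}.
Proof. by move=> f g; apply/funext => n; exact: mulrDr. Qed.
Definition scale_coef r : endo (nat -> R) := endo_of (scale_coef_subproof r).

Fact scale_coef_zmod_morphism : zmod_morphism scale_coef.
Proof. by move=> r s; apply: endoP => f; apply/funext => n; exact: mulrBl. Qed.
Fact scale_coef_monoid_morphism : monoid_morphism scale_coef.
Proof.
split=> [|r s]; apply: endoP => f; apply/funext => n; first exact: mul1r.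
by rewrite /= mulrA.
Qed.
HB.instance Definition _ := GRing.isZmodMorphism.Build R (endo (nat -> R))
  scale_coef scale_coef_zmod_morphism.
HB.instance Definition _ := GRing.isMonoidMorphism.Build R (endo (nat -> R))
  scale_coef scale_coef_monoid_morphism.

(** Coefficients of x * (sum_n f_n x^n) as prescribed by
    x f_n = sigma(f_n) x + delta(f_n). *)
Definition lmulx_coef (f : nat -> R) n : R :=
  (if n is m.+1 then sigma (f m) else 0) + delta (f n).

Fact lmulx_coef_subproof : {morph lmulx_coef : f g / f + g}.
Proof.
move=> f g; apply/funext => n; rewrite /lmulx_coef [RHS]addrACA.
rewrite [delta _]delta_der.1; congr (_ + _).
by case: n => [|n]; rewrite ?addr0 // -rmorphD.
Qed.
Definition lmulx : endo (nat -> R) := endo_of lmulx_coef_subproof.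

Lemma lmulx_scale_coef r :
  lmulx * scale_coef r
    = scale_coef (sigma r) * lmulx + scale_coef (delta r).
Proof.
apply: endoP => f; apply/funext => n.
rewrite endo_addE !endo_mulE /= /lmulx_coef.
rewrite [RHS]/(_ * _ + _ * _) delta_der.2 mulrDr.
rewrite [_ * f n + _]addrC addrA; congr (_ + _ + _).
by case: n => [|n]; rewrite ?mulr0 // rmorphM.
Qed.

(** The n-th coefficient of x^i applied to the series 1: since sigma(1) = 1 and
    delta(1) = 0, the operator moves each monomial to the next one. *)
Lemma lmulx_exp_coef i : val (lmulx ^+ i) (fun n => (n == 0)%:R)
  = (fun n => (n == i)%:R).
Proof.
elim: i => // i IH; rewrite exprS endo_mulE IH.
apply/funext => n /=; rewrite /lmulx_coef.
have -> : delta (n == i)%:R = 0.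
  by case: eqP; rewrite ?skew_derivation0 ?skew_derivation1.
by case: n => [|n]; rewrite ?addr0 // rmorph_nat.
Qed.

Section Criterion.
Variables (S : pzRingType) (iota : {rmorphism R -> S}) (x : S).
Hypothesis xr : forall r, x * iota r = iota (sigma r) * x + iota (delta r).
(** S is generated as a ring by x and the image of R. *)
Hypothesis S_gen : forall P : S -> Prop,
  (forall a c, P a -> P c -> P (a + c)) -> (forall a, P a -> P (- a)) ->
  (forall a c, P a -> P c -> P (a * c)) ->
  (forall r, P (iota r)) -> P x -> forall a, P a.

(** The set of left combinations of powers of x is stable under left
    multiplication by x, thanks to the commutation rule, and by R; hence by
    everything that these generate, and it contains 1. *)
Lemma skew_poly_span v :
  exists (s : seq nat) (c : nat -> R), v = \sum_(i <- s) iota (c i) * x ^+ i.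
Proof.
(* Lists of monomials, rather than an index list with one coefficient
   function, make sums of combinations mere concatenations. *)
pose span (v : S) := exists l : seq (nat * R),
  v = \sum_(p <- l) iota p.2 * x ^+ p.1.
have spanD a c : span a -> span c -> span (a + c).
  by move=> [l ->] [l' ->]; exists (l ++ l'); rewrite big_cat.
have spanZ r a : span a -> span (iota r * a).
  move=> [l ->]; exists [seq (p.1, r * p.2) | p <- l].
  by rewrite big_map mulr_sumr; apply: eq_bigr => p _; rewrite rmorphM mulrA.
have spanX a : span a -> span (x * a).
  move=> [l ->]; rewrite mulr_sumr.
  under eq_bigr do rewrite mulrA xr mulrDl -mulrA -exprS.
  rewrite big_split; apply: spanD.
    by exists [seq (p.1.+1, sigma p.2) | p <- l]; rewrite big_map.
  by exists [seq (p.1, delta p.2) | p <- l]; rewrite big_map.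
have spanM a w : span w -> span (a * w).
  elim/S_gen: a w => [a c aP cP w wP|a aP w wP|a c aP cP w wP|r w wP|w wP].
  - by rewrite mulrDl; apply: spanD; [exact: aP | exact: cP].
  - rewrite mulNr -mulrN; apply: aP.
    by rewrite -[w]mul1r -mulNr -(rmorph1 iota) -rmorphN; exact: spanZ.
  - by rewrite -mulrA; apply/aP/cP.
  - exact: spanZ.
  - exact: spanX.
have [l ->] : span v.
  rewrite -[v]mulr1; apply: spanM; exists [:: (0%N, 1)].
  by rewrite big_seq1 rmorph1 mulr1.
exists (undup (map fst l)), (fun i => \sum_(p <- l | p.1 == i) p.2).
rewrite -(sum_undup_map fst); apply: eq_bigr => i _.
by rewrite rmorph_sum mulr_suml; apply: eq_bigr => p /eqP ->.
Qed.

(** Independence is read off the action: a combination of powers of x sends the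
    series 1 to the series with the same coefficients. *)
Lemma is_skew_poly_of_rep (rep : {rmorphism S -> endo (nat -> R)}) :
  (forall r, rep (iota r) = scale_coef r) -> rep x = lmulx ->
  is_skew_poly iota x sigma delta.
Proof.
move=> rep_iota rep_x; split=> //.
split; first exact: skew_poly_span.
move=> s c s_uniq; rewrite left_mod_sumE => sum0 i si.
have := congr1 (fun a => val (rep a) (fun n => (n == 0)%:R) i) sum0.
rewrite rmorph_sum endo_sumE rmorph0 => rep_sum0; rewrite -[RHS]rep_sum0.
rewrite fct_sumE (bigD1_seq i) //= big1 => [|k k_neq_i].
  by rewrite rmorphM rmorphXn rep_iota rep_x endo_mulE lmulx_exp_coef /= eqxx
    mulr1 addr0.
rewrite rmorphM rmorphXn rep_iota rep_x endo_mulE lmulx_exp_coef /=.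
by rewrite eq_sym (negPf k_neq_i) mulr0.
Qed.

End Criterion.

End SkewDerivation.

Inductive skew_poly_rel (R : pzRingType) (sigma delta : R -> R) :
    term R unit -> term R unit -> Prop :=
| skew_poly_xr r : skew_poly_rel sigma delta
    (Mul (Gen tt) (Cst r))
    (Add (Mul (Cst (sigma r)) (Gen tt)) (Cst (delta r))).

(** Existence of R[x; sigma, delta]: the ring defined by the commutation rule
    acts on series over R, because left multiplication by x on series obeys
    that rule. *)
Lemma presented_skew_poly (R : pzRingType) (sigma : {rmorphism R -> R})
    (delta : R -> R) :
  is_skew_derivation sigma delta ->
  is_skew_poly (@pcst R unit (skew_poly_rel sigma delta)) (pgen _ tt)
    sigma delta.
Proof.
move=> delta_der.
have [s t []|rep [rep_cst rep_gen _]] := @presented_univ R unit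
  (skew_poly_rel sigma delta) (endo (nat -> R)) (@scale_coef R)
  (fun _ => lmulx delta_der); first by move=> r; exact: lmulx_scale_coef.
apply: (@is_skew_poly_of_rep _ _ _ delta_der _ _ _ _ _ rep) => //.
- by move=> r; exact: (presented_rel (skew_poly_xr sigma delta r)).
- move=> P PD PN PM Pcst Px; apply: presented_ind => // -[]; exact: Px.
Qed.

(** * Triangular matrices and skew derivations *)

Definition upper_tri (R : pzRingType) (a d c : R) : 'M[R]_2 :=
  \matrix_(i < 2, j < 2)
    if i == 0 :> nat then (if j == 0 :> nat then a else d)
    else (if j == 0 :> nat then 0 else c).

Section UpperTriangular.
Variable R : pzRingType.
Implicit Types a d c : R.

Lemma upper_triD a d c a' d' c' :
  upper_tri a d c + upper_tri a' d' c' = upper_tri (a + a') (d + d') (c + c').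
Proof.
by apply/matrixP => -[[|[]] ? //] [[|[]] ? //]; rewrite !mxE //= addr0.
Qed.

Lemma upper_triN a d c : - upper_tri a d c = upper_tri (- a) (- d) (- c).
Proof.
by apply/matrixP => -[[|[]] ? //] [[|[]] ? //]; rewrite !mxE //= oppr0.
Qed.

Lemma upper_triM a d c a' d' c' :
  upper_tri a d c * upper_tri a' d' c'
    = upper_tri (a * a') (a * d' + d * c') (c * c').
Proof.
by apply/matrixP => -[[|[]] ? //] [[|[]] ? //];
  rewrite !mxE !big_ord_recl big_ord0 !mxE //= ?mul0r ?mulr0 ?add0r ?addr0.
Qed.

Lemma upper_tri1 : upper_tri 1 0 1 = 1 :> 'M[R]_2.
Proof. by apply/matrixP => -[[|[]] ? //] [[|[]] ? //]; rewrite !mxE. Qed.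

Lemma upper_tri_inj a d c a' d' c' :
  upper_tri a d c = upper_tri a' d' c' -> [/\ a = a', d = d' & c = c'].
Proof.
move=> /matrixP e; split.
- by have := e 0 0; rewrite !mxE.
- by have := e 0 1; rewrite !mxE.
- by have := e 1 1; rewrite !mxE.
Qed.

(** Multiplicativity of r |-> [[sigma(r), delta(r)], [0, r]] is
    multiplicativity of sigma on the diagonal and the skew Leibniz rule in the
    corner. *)
Lemma skew_derivation_of_triangular (h : {rmorphism R -> 'M[R]_2}) :
  (forall r, exists a d, h r = upper_tri a d r) ->
  exists (sigma : {rmorphism R -> R}) (delta : R -> R),
    is_skew_derivation sigma delta
    /\ forall r, h r = upper_tri (sigma r) (delta r) r.
Proof.
move=> /choice [s /choice [delta hE]].
have sB : zmod_morphism s.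
  move=> r t; have := rmorphB h r t.
  by rewrite !hE upper_triN upper_triD => /upper_tri_inj[].
have sM : monoid_morphism s.
  split=> [|r t].
    by have := rmorph1 h; rewrite !hE -upper_tri1 => /upper_tri_inj[].
  by have := rmorphM h r t; rewrite !hE upper_triM => /upper_tri_inj[].
pose sigma : {rmorphism R -> R} := HB.pack s
  (GRing.isZmodMorphism.Build _ _ s sB) (GRing.isMonoidMorphism.Build _ _ s sM).
exists sigma, delta; split=> //; split=> r t.
  by have := rmorphD h r t; rewrite !hE upper_triD => /upper_tri_inj[].
have := rmorphM h r t; rewrite !hE upper_triM => /upper_tri_inj[_ -> _].
by rewrite addrC.
Qed.

End UpperTriangular.

(** * The diskew polynomial ring *)

Section Diskew.
Variables (D : pzRingType) (sigma tau : {rmorphism D -> D}) (b rho : D).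
Hypothesis hrho : forall d : D, sigma (tau d) * rho = rho * tau (sigma d).
Hypothesis hb : forall d : D, sigma (tau d) * b = b * d.

Let rel := skew_poly_rel tau (fun _ : D => 0).
Let R : pzRingType := presented rel.
Let iR : {rmorphism D -> R} := @pcst D unit rel.
Let yR : R := pgen rel tt.

Lemma diskew_base_skew_poly : is_skew_poly iR yR tau (fun _ : D => 0).
Proof.
by apply: presented_skew_poly; split=> *; rewrite ?mul0r ?mulr0 addr0.
Qed.

Lemma diskew_base_yd d : yR * iR d = iR (tau d) * yR.
Proof. by case: diskew_base_skew_poly => _ _ ->; rewrite rmorph0 addr0. Qed.

(** The relation y d = tau(d) y between the matrices of y and d amounts, in the
    upper left entry, to rho tau(sigma(d)) = sigma(tau(d)) rho and, in the upper
    right one, to b d = sigma(tau(d)) b. *)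
Lemma diskew_derivation :
  exists (sigmaR : {rmorphism R -> R}) (partial : R -> R),
    [/\ is_skew_derivation sigmaR partial,
        forall d, sigmaR (iR d) = iR (sigma d), sigmaR yR = iR rho * yR,
        forall d, partial (iR d) = 0 & partial yR = iR b].
Proof.
pose tri_cst d : 'M[R]_2 := upper_tri (iR (sigma d)) 0 (iR d).
have tri_cstB : zmod_morphism tri_cst.
  by move=> c d; rewrite /tri_cst upper_triN upper_triD !rmorphB oppr0 addr0.
have tri_cstM : monoid_morphism tri_cst.
  split=> [|c d]; first by rewrite /tri_cst !rmorph1 upper_tri1.
  by rewrite /tri_cst upper_triM !rmorphM mulr0 mul0r addr0.
pose tri_iota : {rmorphism D -> 'M[R]_2} := HB.pack tri_cst
  (GRing.isZmodMorphism.Build _ _ tri_cst tri_cstB)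
  (GRing.isMonoidMorphism.Build _ _ tri_cst tri_cstM).
have [s t [d]|h [h_cst h_gen _]] := @presented_univ D unit rel
  'M[R]_2 tri_iota (fun _ => upper_tri (iR rho * yR) (iR b) yR).
  rewrite /= /tri_cst -[pcst rel]/(iR : D -> R).
  rewrite !upper_triM upper_triD !rmorph0.
  rewrite !mulr0 !mul0r !addr0 !add0r; congr upper_tri.
  - rewrite -mulrA diskew_base_yd !mulrA.
    by rewrite -(rmorphM iR rho) -hrho rmorphM.
  - by rewrite -!rmorphM hb.
  - exact: diskew_base_yd.
have h_tri r : exists a d, h r = upper_tri a d r.
  elim/presented_ind: r => [r s [a [d hr]] [a' [d' hs]]|r [a [d hr]]
      |r s [a [d hr]] [a' [d' hs]]|d|[]].
  - by rewrite rmorphD hr hs upper_triD; do 2!eexists.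
  - by rewrite rmorphN hr upper_triN; do 2!eexists.
  - by rewrite rmorphM hr hs upper_triM; do 2!eexists.
  - by rewrite h_cst; do 2!eexists.
  - by rewrite h_gen; do 2!eexists.
have [sigmaR [partial [partial_der hE]]] := skew_derivation_of_triangular h_tri.
have val_cst d : sigmaR (iR d) = iR (sigma d) /\ partial (iR d) = 0.
  by have := h_cst d; rewrite hE => /upper_tri_inj[].
have val_y : sigmaR yR = iR rho * yR /\ partial yR = iR b.
  by have := h_gen tt; rewrite hE => /upper_tri_inj[].
by exists sigmaR, partial; split=> // [d||d|];
  [case: (val_cst d) | case: val_y | case: (val_cst d) | case: val_y].
Qed.

(** The relations x d = sigma(d) x and x y - rho y x = b are the commutation
    rule of x with the generators of R, and that rule propagates to all of R.
    Conversely, on series over R, the left multiplications by x, y and D satisfy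
    the relations of the diskew ring, which gives the action used for
    independence. *)
Lemma diskew_iterated (sigmaR : {rmorphism R -> R}) (partial : R -> R) :
  is_skew_derivation sigmaR partial ->
  (forall d, sigmaR (iR d) = iR (sigma d)) -> sigmaR yR = iR rho * yR ->
  (forall d, partial (iR d) = 0) -> partial yR = iR b ->
  exists j : {rmorphism R -> diskew sigma tau b rho},
    [/\ forall d, j (iR d) = diskew_cst sigma tau b rho d,
        j yR = diskew_y sigma tau b rho
      & is_skew_poly j (diskew_x sigma tau b rho) sigmaR partial].
Proof.
move=> der sigma_cst sigma_y partial_cst partial_y.
have [xdE ydE xyE] := diskew_relE sigma tau b rho.
set iE := diskew_cst sigma tau b rho in xdE ydE xyE *.
set x := diskew_x sigma tau b rho in xdE ydE xyE *.
set y := diskew_y sigma tau b rho in xdE ydE xyE *.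
have [_ _ [d]|j [j_cst j_gen _]] := @presented_univ D unit rel
  (diskew sigma tau b rho) iE (fun _ => y).
  by rewrite /= rmorph0 addr0 ydE.
have j_y : j yR = y by exact: j_gen.
exists j; split=> //.
have xr r : x * j r = j (sigmaR r) * x + j (partial r).
  elim/presented_ind: r => [r s IHr IHs|r IHr|r s IHr IHs|d|[]].
  - by rewrite rmorphD mulrDr IHr IHs !rmorphD der.1 rmorphD mulrDl addrACA.
  - by rewrite rmorphN mulrN IHr !rmorphN (skew_derivationN der) rmorphN
      mulNr opprD.
  - rewrite rmorphM mulrA IHr mulrDl -mulrA IHs mulrDr !mulrA der.2.
    by rewrite !rmorphM rmorphD !rmorphM -addrA [_ * _ + j _ * _]addrC.
  - by rewrite sigma_cst partial_cst !j_cst xdE rmorph0 addr0.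
  - rewrite sigma_y partial_y rmorphM !j_cst j_y -mulrA -xyE.
    by rewrite addrC subrK.
pose L : {rmorphism R -> endo (nat -> R)} := @scale_coef R.
have [_ _ [d|d|]|rep [rep_cst rep_gen _]] := @presented_univ D xy
  (diskew_rel sigma tau b rho) (endo (nat -> R)) (L \o iR)
  (fun g => if g is gen_x then lmulx der else L yR).
- rewrite /= lmulx_scale_coef partial_cst sigma_cst.
  by rewrite rmorph0 addr0.
- by rewrite /= -!(rmorphM L) diskew_base_yd.
- rewrite /= lmulx_scale_coef partial_y sigma_y.
  by rewrite (rmorphM L) -mulrA addrAC subrr add0r.
apply: (@is_skew_poly_of_rep _ _ _ der _ _ _ _ _ rep) => //.
- move=> P PD PN PM Pj Px; apply: presented_ind => // [d|[]] //.
  + by have := Pj (iR d); rewrite j_cst.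
  + by have := Pj yR; rewrite j_y.
- elim/presented_ind => [r s IHr IHs|r IHr|r s IHr IHs|d|[]].
  + by rewrite !rmorphD IHr IHs.
  + by rewrite !rmorphN IHr.
  + by rewrite !rmorphM IHr IHs.
  + by rewrite j_cst rep_cst.
  + by rewrite j_y rep_gen.
- exact: rep_gen.
Qed.

End Diskew.

Theorem theorem5p1 (D : pzRingType) (sigma tau : {rmorphism D -> D})
    (b rho : D)
    (hrho : forall d : D, sigma (tau d) * rho = rho * tau (sigma d))
    (hb : forall d : D, sigma (tau d) * b = b * d) :
  let E := diskew sigma tau b rho in
  let iE : {rmorphism D -> E} := diskew_cst sigma tau b rho in
  let x : E := diskew_x sigma tau b rho in
  let y : E := diskew_y sigma tau b rho in
  [/\ exists (R : pzRingType) (iR : {rmorphism D -> R}) (yR : R)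
             (sigmaR : {rmorphism R -> R}) (partial : R -> R)
             (j : {rmorphism R -> E}),
        [/\ is_skew_poly iR yR tau (fun _ : D => 0),
            (forall d : D, sigmaR (iR d) = iR (sigma d))
              /\ sigmaR yR = iR rho * yR,
            (forall d : D, partial (iR d) = 0) /\ partial yR = iR b,
            (forall d : D, j (iR d) = iE d) /\ j yR = y
          & is_skew_poly j x sigmaR partial],
      is_basis (fun ij : nat * nat => y ^+ ij.1 * x ^+ ij.2 : left_mod iE)
    & left_regular x].
Proof.
move=> E iE x y.
have [sigmaR [partial [der sigma_cst sigma_y partial_cst partial_y]]] :=
  diskew_derivation hrho hb.
have [j [j_cst j_y E_skew_poly]] :=
  diskew_iterated der sigma_cst sigma_y partial_cst partial_y.
have R_skew_poly := diskew_base_skew_poly tau.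
split.
- by do 6!eexists; split; [exact: R_skew_poly | split; [exact: sigma_cst | ]
    | split; [exact: partial_cst | ] | split; [exact: j_cst | ]
    | exact: E_skew_poly].
- case: R_skew_poly E_skew_poly => _ yB _ [_ xB _].
  have := basis_tower j_cst yB xB.
  by congr is_basis; apply/funext => k; rewrite rmorphXn j_y.
- exact: skew_poly_left_regular E_skew_poly.
Qed.
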